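(* For all integers $1\le k\le n$, $$V_{n,k}(t)=\sum_{[\sigma]\in\mathcal{FL}^{(B)}_{n,n-k+1}}t^{\,n+1-2\cdot\mathsf{spk}([\sigma])}\qquad\text{and}\qquad V_{n,-k}(t)=\sum_{[\sigma]\in\mathcal{FL}^{(D)}_{n,n-k+1}}t^{\,n+1-2\cdot \mathsf{spk}([\sigma])}.$$
   Context: Arnold–Hoffman polynomials: for integers $1\le |k|\le n$ define $V_{n,k}(t)$ by $V_{1,1}=t^2$, $V_{1,-1}=1$, $V_{n,-n}=0$ for $n\ge 2$, and $V_{n,-k}=V_{n,-k-1}+t^{-1}V_{n-1,k}$ for $n>k\ge 1$; $V_{n,1}=t^2V_{n,-1}$ for $n\ge2$; $V_{n,k}=V_{n,k-1}+tV_{n-1,-k+1}$ for $n\ge k>1$. Signed permutations of $[n]$ are written in window notation $\sigma=\sigma_1\cdots\sigma_n$ (entries in $\{\pm1,\dots,\pm n\}$ with $|\sigma_1|,\dots,|\sigma_n|$ a permutation of $[n]$); $\bar a=-a$. For $1\le k\le n$, $\sigma_k\cdots\sigma_1\sigma_{k+1}\cdots\sigma_n$ is a flip of $\sigma$ if $k=n$ or $|\sigma_{k+1}|<\min\{|\sigma_i|:1\le i\le k\}$. Flip equivalence is the equivalence relation generated by flips; $[\sigma]$ is the class of $\sigma$. Signed maximum: for a nonempty word $\sigma$ of nonzero integers with distinct absolute values, write $\sigma=\sigma_L\hat\sigma\sigma_R$ with $|\hat\sigma|=\min|\sigma|$, and define recursively: (1) if $\sigma_L,\sigma_R$ are empty,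 $\mathsf{smax}(\sigma)=\hat\sigma$; (2) if $\sigma_L$ empty, $\sigma_R$ nonempty: $\mathsf{smax}(\sigma)=\hat\sigma$ if $\hat\sigma>0$, and $=\mathsf{smax}(\sigma_R)$ if $\hat\sigma<0$; (3) if $\sigma_L$ nonempty, $\sigma_R$ empty: $\mathsf{smax}(\sigma)=\hat\sigma$ if $\hat\sigma>0$, and $=\mathsf{smax}(\sigma_L)$ if $\hat\sigma<0$; (4) if both nonempty and $\hat\sigma>0$: $\mathsf{smax}(\sigma)=\mathsf{smax}(\sigma_L)$ if $\min|\sigma_L|>\min|\sigma_R|$ and $=\mathsf{smax}(\sigma_R)$ if $\min|\sigma_L|<\min|\sigma_R|$; (5) if both nonempty and $\hat\sigma<0$: $\mathsf{smax}(\sigma)=\mathsf{smax}(\sigma_L)$ if $\min|\sigma_L|<\min|\sigma_R|$ and $=\mathsf{smax}(\sigma_R)$ if $\min|\sigma_L|>\min|\sigma_R|$. This value is constant on flip classes; set $\mathsf{smax}([\sigma])=\mathsf{smax}(\sigma)$. $\mathcal{FL}^{(B)}_{n,k}$ is the set of flip classes of signed permutations of $[n]$ with $\mathsf{smax}=k$, and $\mathcal{FL}^{(D)}_{n,k}$ the set of those with $\mathsf{smax}=-k$. Signed peak: $\mathsf{spk}(\sigma)=\#\{i: 1\le i\le n,\ \sigma_i<0,\ |\sigma_{i-1}|<|\sigma_i|>|\sigma_{i+1}|\}$ with $\sigma_0=\sigma_{n+1}=0$; it is constant on flip classes, and $\mathsf{spk}([\sigma])=\mathsf{spk}(\sigma)$.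 *)

(* Defs.v *)
From mathcomp Require Import all_boot all_order all_fingroup all_algebra.
Set Implicit Arguments.
Unset Strict Implicit.
Unset Printing Implicit Defensive.
Import Order.TTheory GRing.Theory Num.Theory.
Local Open Scope ring_scope.

(* The recurrence for the Arnold-Hoffman polynomials uses t^-1, so they are   *)
(* defined as rational functions in an indeterminate t with integer           *)
(* coefficients.                                                              *)
Notation ratfrac := {fraction {poly int}}.
Definition t : ratfrac := tofrac 'X.

(* Row n >= 2 computed from row n-1, called W.  AH_neg n W d is V_{n,-(n-d)}: *)
(* the recurrence on negative indices descends from V_{n,-n} = 0.             *)
Fixpoint AH_neg (n : nat) (W : int -> ratfrac) (d : nat) : ratfrac :=
  if d is d'.+1 then AH_neg n W d' + t^-1 * W (n - d)%N%:Z else 0.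

(* AH_pos n W j is V_{n,j+1}. *)
Fixpoint AH_pos (n : nat) (W : int -> ratfrac) (j : nat) : ratfrac :=
  if j is j'.+1 then AH_pos n W j' + t * W (- j%:Z)
  else t ^+ 2 * AH_neg n W n.-1.

(* Only the values at 1 <= |k| <= n are meaningful; the recurrences never     *)
(* use any other value (see the lemmas V_one_pos to V_pos below).             *)
Fixpoint V (n : nat) (k : int) : ratfrac :=
  match n with
  | 0 => 0
  | 1 => if k == 1 then t ^+ 2 else if k == - 1 then 1 else 0
  | n'.+1 =>
    match k with
    | Posz 0 => 0
    | Posz j.+1 => AH_pos n (V n') j
    | Negz j => AH_neg n (V n') (n - j.+1)
    end
  end.

Lemma V_one_pos : V 1 1 = t ^+ 2. Proof. by []. Qed.

Lemma V_one_neg : V 1 (- 1) = 1. Proof. by []. Qed.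

Lemma V_negn (n : nat) : (2 <= n)%N -> V n (- n%:Z) = 0.
Proof. by case: n => [|[|n]] // _; rewrite -NegzE /V subnn. Qed.

Lemma V_neg (n k : nat) : (1 <= k < n)%N ->
  V n (- k%:Z) = V n (- k%:Z - 1) + t^-1 * V n.-1 k%:Z.
Proof.
case: n => [|[|n]]; case: k => [|k] //; rewrite ?ltn0 ?andbF // ltnS => kn.
have -> : - k.+1%:Z - 1 = Negz k.+1 by rewrite NegzE -opprD -[k.+2]addn1 PoszD.
rewrite -NegzE /V -/V.
have E : (n.+2 - k.+1 = (n.+2 - k.+2).+1)%N by rewrite -subSn // !subSS.
by rewrite {1}E /= -E subKn // ltnW.
Qed.

Lemma V_pos1 (n : nat) : (2 <= n)%N -> V n 1 = t ^+ 2 * V n (- 1).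
Proof.
by case: n => [|[|n]] // _; rewrite -[- 1]/(Negz 0) /V -/V subn1.
Qed.

Lemma V_pos (n k : nat) : (1 < k <= n)%N ->
  V n k%:Z = V n (k%:Z - 1) + t * V n.-1 (- k%:Z + 1).
Proof.
case: n => [|[|n]]; case: k => [|[|k]] // _.
have -> : k.+2%:Z - 1 = k.+1%:Z by rewrite -[k.+2]addn1 PoszD addrK.
have -> : - k.+2%:Z + 1 = - k.+1%:Z by rewrite -[k.+2]addn1 PoszD opprD addrNK.
by [].
Qed.

(* min |w|; meant for nonempty words only. *)
Definition minabs (w : seq int) : nat :=
  foldr minn (absz (head 0 w)) (map absz w).

(* The decomposition w = wL ++ what :: wR around the letter of minimal        *)
(* absolute value.                                                            *)
Definition hat_pos (w : seq int) : nat :=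
  index (minabs w) (map absz w).
Definition hat (w : seq int) : int := nth 0 w (hat_pos w).
Definition wL (w : seq int) : seq int := take (hat_pos w) w.
Definition wR (w : seq int) : seq int := drop (hat_pos w).+1 w.

Definition smax_step (rec : seq int -> int) (w : seq int) : int :=
  match wL w, wR w with
  | [::], [::] => hat w
  | [::], _ => if 0 < hat w then hat w else rec (wR w)
  | _, [::] => if 0 < hat w then hat w else rec (wL w)
  | _, _ =>
    if 0 < hat w
    then if (minabs (wR w) < minabs (wL w))%N then rec (wL w) else rec (wR w)
    else if (minabs (wL w) < minabs (wR w))%N then rec (wL w) else rec (wR w)
  end.

(* The recursive calls are on shorter words, so the length of the word bounds *)
(* the depth of the recursion; smaxE is the resulting recursive equation.     *)
Fixpoint smax_rec (m : nat) (w : seq int) : int :=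
  if m is m'.+1 then smax_step (smax_rec m') w else 0.

Definition smax (w : seq int) : int := smax_rec (size w) w.

Lemma hat_pos_lt (w : seq int) : w != [::] -> (hat_pos w < size w)%N.
Proof.
case: w => // x w _; rewrite /hat_pos -(size_map absz) index_mem /minabs /=.
set a := `|x|%N; set s := map _ w.
have : foldr minn a s \in a :: s.
  elim: s => [|b s IH] /=; first by rewrite mem_head.
  rewrite /minn; case: ifP => _; first by rewrite !inE eqxx orbT.
  by move: IH; rewrite !inE => /orP[->|->]; rewrite ?orbT.
by rewrite {2}/minn; case: ifP => // _ _; rewrite mem_head.
Qed.

Lemma smax_rec_enough (m1 m2 : nat) (w : seq int) :
  (size w <= m1)%N -> (size w <= m2)%N -> smax_rec m1 w = smax_rec m2 w.
Proof.
have small m : smax_rec m [::] = 0 by case: m.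
elim: m1 m2 w => [|m1 IH] m2 w; first by case: w.
case: (eqVneq w [::]) => [-> _ _|w0]; first by rewrite !small.
have iw := hat_pos_lt w0.
case: m2 => [|m2] w1 w2; first by rewrite leqn0 size_eq0 (negPf w0) in w2.
have sL : (size (wL w) < size w)%N by rewrite size_takel // ltnW.
have sR : (size (wR w) < size w)%N.
  by rewrite size_drop subnS prednK ?subn_gt0 // leq_subr.
rewrite /= /smax_step.
have EL : smax_rec m1 (wL w) = smax_rec m2 (wL w).
  by apply: IH; rewrite -ltnS (leq_trans sL).
have ER : smax_rec m1 (wR w) = smax_rec m2 (wR w).
  by apply: IH; rewrite -ltnS (leq_trans sR).
by rewrite EL ER.
Qed.

Lemma smaxE (w : seq int) : w != [::] -> smax w = smax_step smax w.
Proof.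
move=> w0; rewrite /smax; case Ew: (size w) => [|m].
  by move/eqP: Ew; rewrite size_eq0 (negPf w0).
have iw := hat_pos_lt w0.
have sL : (size (wL w) <= m)%N by rewrite size_takel ?(ltnW iw) // -ltnS -Ew.
have sR : (size (wR w) <= m)%N by rewrite size_drop Ew subSS leq_subr.
by rewrite /= /smax_step (smax_rec_enough sL (leqnn _))
  (smax_rec_enough sR (leqnn _)).
Qed.

(* Padding by w_0 = w_{n+1} = 0 puts the letter w_i at position i.            *)
Definition spk (w : seq int) : nat :=
  let p := 0 :: rcons w 0 in
  count (fun i => [&& nth 0 p i < 0,
                      (absz (nth 0%R p i.-1) < absz (nth 0%R p i))%N
                    & (absz (nth 0%R p i.+1) < absz (nth 0%R p i))%N])
        (iota 1 (size w)).

(* A signed permutation of [n] is a pair of a permutation s of {0, ..., n-1}  *)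
(* and the set of positions carrying a minus sign.                            *)
Definition sperm (n : nat) : finType := ({perm 'I_n} * {set 'I_n})%type.

Definition window (n : nat) (s : sperm n) : seq int :=
  [seq (if i \in s.2 then - (s.1 i).+1%:Z else (s.1 i).+1%:Z) | i <- enum 'I_n].

Definition flippable (k : nat) (w : seq int) : bool :=
  (k == size w) || (absz (nth 0%R w k) < minabs (take k w))%N.

Definition flip_word (k : nat) (w : seq int) : seq int :=
  rev (take k w) ++ drop k w.

Definition is_flip (n : nat) (s s' : sperm n) : bool :=
  [exists k : 'I_n.+1, [&& (0 < k)%N, flippable k (window s)
                         & window s' == flip_word k (window s)]].

Definition flip_equiv (n : nat) : rel (sperm n) :=
  connect (fun s s' => is_flip s s' || is_flip s' s).

Definition flip_classes (n : nat) : {set {set sperm n}} :=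
  equivalence_partition (@flip_equiv n) [set: sperm n].

(* smax and spk are constant on flip classes: any representative will do.     *)
Definition smax_class (n : nat) (C : {set sperm n}) : int :=
  if [pick s in C] is Some s then smax (window s) else 0.

Definition spk_class (n : nat) (C : {set sperm n}) : nat :=
  if [pick s in C] is Some s then spk (window s) else 0%N.

Definition FLB (n k : nat) : {set {set sperm n}} :=
  [set C in flip_classes n | smax_class C == k%:Z].

Definition FLD (n k : nat) : {set {set sperm n}} :=
  [set C in flip_classes n | smax_class C == - k%:Z].

(* Main.v *)
Require Import Defs.
From mathcomp Require Import all_boot all_order all_fingroup all_algebra.
From mathcomp Require Import zify ring.
Import Order.TTheory GRing.Theory Num.Theory.
Local Open Scope ring_scope.
Set Implicit Arguments.
Unset Strict Implicit.
Unset Printing Implicit Defensive.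

(* A flip class is an increasing binary tree whose nodes have unordered        *)
(* children: writing w = L c R with |c| minimal, the flips permute L with R    *)
(* and act inside L and R.  Ordering the two children so that the smaller      *)
(* minimum is on the left gives one normal word per class.  Weight a word by   *)
(* u^spk, u = t^-2.  When both children are present, exactly one sign of c     *)
(* makes smax descend into a given child, so that the sum over normal words    *)
(* on a :: s with smax = x satisfies, for s nonempty,                          *)
(*   Q_x(a :: s) = [x = a] Tot(s) + \sum_(A, B) Q_x(A) Tot(B),                 *)
(* over all ordered splittings of s into A and B.  Comparing x with the next   *)
(* letter in absolute value, the splittings separating the two cancel, and     *)
(* induction yields the recurrences of the Arnold-Hoffman polynomials.         *)

(** In the increasing binary tree of a word, a letter exceeds both of its neighbours in absolute
    value exactly when it is a leaf, so [spk] counts the negative leaves. Like [smax], it depends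
    only on the unordered tree. Two words are flip equivalent exactly when they have the same normal
    form [nf] ([flip_equivE]), and [words] lists the normal words without repetition ([words_sound],
    [words_complete], [uniq_words]). Hence [sum_flip_classes] replaces flip classes by normal words.

    Removing the root gives [total_cons] and [smax_total_cons]: the sign of a root with children
    does not affect the weight, and it only decides whether [smax] stops or which child it follows.
    By induction the sums depend only on the sign [e] of the signed maximum and on the numbers [p]
    and [r] of letters smaller and larger than it in absolute value. This is [phi e p r], with n = p
    + r + 1 and k = r + 1.

    Trading a smaller letter for a larger one changes [phi] by a difference which, by
    [phi_exchange], obeys the same recursion in [p] as [phi] itself ([phi_S]). An identity checked
    at p = 0 therefore propagates, which yields [phi_neg] and [phi_pos]. With [phi_0] and [phi_max]
    as boundary values, these become the defining recurrences of V after setting u = t^-2 and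
    multiplying by t^(n+1) ([V_phi]). *)

Definition above (c : int) (w : seq int) : bool := all (fun x => (`|c| < `|x|)%N) w.

Definition good (w : seq int) : bool := uniq (map absz w) && (0 \notin w).

Lemma aboveP (c : int) (w : seq int) :
  reflect (forall x, x \in w -> (`|c| < `|x|)%N) (above c w).
Proof. exact: allP. Qed.

Lemma minabs_spec (w : seq int) : w != [::] ->
  minabs w \in map absz w /\ forall x, x \in w -> (minabs w <= `|x|)%N.
Proof.
case: w => // y w _; rewrite /minabs /=; set f := foldr minn _ _.
have [fm fl] : f \in `|y|%N :: map absz w /\ forall x, x \in y :: w -> (f <= `|x|)%N.
  rewrite {}/f; elim: w => [|z w [IH1 IH2]] /=.
    by split=> [|x]; rewrite mem_seq1 // => /eqP->.
  split.
    by rewrite /minn; case: ifP => _; move: IH1; rewrite !inE ?eqxx ?orbT // => /orP[->|->]; rewrite ?orbT.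
  move=> x; rewrite !inE => /or3P[/eqP->|/eqP->|xw]; rewrite geq_min ?leqnn //.
    by rewrite IH2 ?mem_head ?orbT.
  by rewrite IH2 ?orbT // inE xw orbT.
rewrite /minn; case: ifP => [yf|_]; split=> //; first exact: mem_head.
by move=> x xw; rewrite (leq_trans _ (fl _ xw)) //; exact/ltnW.
Qed.

Lemma minabsE (w : seq int) (c : int) : c \in w ->
  (forall x, x \in w -> (`|c| <= `|x|)%N) -> minabs w = `|c|%N.
Proof.
move=> cw cl; have [|/mapP[x xw mx] ml] := @minabs_spec w; first by case: w cw {cl}.
by apply/eqP; rewrite eqn_leq ml //= mx cl.
Qed.

Lemma minabs_perm (w w' : seq int) :
  perm_eq (map absz w) (map absz w') -> minabs w = minabs w'.
Proof.
move=> pw; case: (eqVneq w [::]) pw => [->|w0] pw.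
  by move/perm_size: pw; case: w' => //.
have w0' : w' != [::] by case: w' pw => // /perm_size; case: w w0.
have [m1 l1] := minabs_spec w0; have [m2 l2] := minabs_spec w0'.
apply/eqP; rewrite eqn_leq; apply/andP; split.
  by move: m2; rewrite -(perm_mem pw) => /mapP[x xw ->]; apply: l1.
by move: m1; rewrite (perm_mem pw) => /mapP[x xw ->]; apply: l2.
Qed.

Lemma above_minabs (c : int) (w : seq int) : w != [::] ->
  (`|c| < minabs w)%N = above c w.
Proof.
move=> w0; have [/mapP[x xw mx] ml] := minabs_spec w0.
apply/idP/aboveP => [cm y yw|H]; first exact: leq_trans cm (ml _ yw).
by rewrite mx H.
Qed.

Section Decomposition.
Context (L R : seq int) (c : int) (aL : above c L) (aR : above c R).

Lemma minabs_cat : minabs (L ++ c :: R) = `|c|%N.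
Proof.
apply: minabsE; first by rewrite mem_cat mem_head orbT.
move=> x; rewrite mem_cat inE => /or3P[xL|/eqP->//|xR]; apply: ltnW.
  exact: (aboveP _ _ aL).
exact: (aboveP _ _ aR).
Qed.

Lemma hat_pos_cat : hat_pos (L ++ c :: R) = size L.
Proof.
rewrite /hat_pos minabs_cat map_cat index_cat size_map /=.
case: ifP => [/mapP[x xL E]|_]; last by rewrite eqxx addn0.
by have := aboveP _ _ aL x xL; rewrite E ltnn.
Qed.

Lemma hat_cat : hat (L ++ c :: R) = c.
Proof. by rewrite /hat hat_pos_cat nth_cat ltnn subnn. Qed.

Lemma wL_cat : wL (L ++ c :: R) = L.
Proof. by rewrite /wL hat_pos_cat take_size_cat. Qed.

Lemma wR_cat : wR (L ++ c :: R) = R.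
Proof. by rewrite /wR hat_pos_cat -cat_rcons drop_size_cat ?size_rcons. Qed.

End Decomposition.

Lemma good_perm (w w' : seq int) : perm_eq w w' -> good w = good w'.
Proof.
by move=> pw; rewrite /good (perm_mem pw) (perm_uniq (perm_map absz pw)).
Qed.

Lemma good_cat (L R : seq int) (c : int) :
  good (L ++ c :: R) -> [/\ good L, good R & c != 0].
Proof.
rewrite /good map_cat cat_uniq mem_cat inE /= !negb_or eq_sym.
by case/andP=> /and3P[-> _ /andP[_ ->]] /and3P[-> -> ->].
Qed.

(** This is induction on the increasing binary tree. Distinct absolute values make the minimum
    strict, which gives the two [above] hypotheses. *)
Lemma word_ind (P : seq int -> Prop) :
  P [::] ->
  (forall L c R, good (L ++ c :: R) -> above c L -> above c R ->
     P L -> P R -> P (L ++ c :: R)) ->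
  forall w, good w -> P w.
Proof.
move=> P0 PS w; have [m] := ubnP (size w); elim: m w => // m IH w sw gw.
have [->//|w0] := eqVneq w [::].
have hw := hat_pos_lt w0.
have Ew : w = wL w ++ hat w :: wR w.
  by rewrite /wL /hat /wR -drop_nth // cat_take_drop.
have [/mapP[x0 x0w mx] ml] := minabs_spec w0.
have hm : `|hat w|%N = minabs w.
  by rewrite /hat -(nth_map _ 0%N) ?nth_index ?mx ?map_f.
move: (wL w) (hat w) (wR w) Ew hm => L c R Ew hm.
rewrite -hm in ml; rewrite {}Ew {mx x0w x0 hm w0 hw} in sw gw ml *.
have nc x : x \in L ++ R -> (`|c| < `|x|)%N.
  have : uniq (map absz (c :: (L ++ R))).
    case/andP: gw => u _; rewrite (perm_uniq (_ : perm_eq _ (map absz (L ++ c :: R)))) //.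
    by apply: perm_map; rewrite perm_sym -cat1s perm_catCA.
  case/andP=> cn _ xLR; rewrite ltn_neqAle; apply/andP; split.
    by apply: contra cn => /eqP ->; apply: map_f.
  by apply: ml; move: xLR; rewrite !mem_cat inE => /orP[->|->]; rewrite ?orbT.
have [gL gR _] := good_cat gw.
apply: PS => //.
- by apply/aboveP => x xL; rewrite nc // mem_cat xL.
- by apply/aboveP => x xL; rewrite nc // mem_cat xL orbT.
- by apply: IH => //; move: sw; rewrite size_cat /=; lia.
- by apply: IH => //; move: sw; rewrite size_cat /=; lia.
Qed.

(** * The normal form and its invariance under flips *)

(** An only child goes to the left. The test on [L] matters because [minabs [::]] is 0. *)
Definition left_first (L R : seq int) : bool :=
  (R == [::]) || (L != [::]) && (minabs L < minabs R)%N.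

Definition nf_step (rec : seq int -> seq int) (w : seq int) : seq int :=
  if left_first (wL w) (wR w) then rec (wL w) ++ hat w :: rec (wR w)
  else rec (wR w) ++ hat w :: rec (wL w).

Fixpoint nf_rec (m : nat) (w : seq int) : seq int :=
  if m is m'.+1 then if w is [::] then [::] else nf_step (nf_rec m') w else [::].

Definition nf (w : seq int) : seq int := nf_rec (size w) w.

Lemma nf_rec_enough (m1 m2 : nat) (w : seq int) :
  (size w <= m1)%N -> (size w <= m2)%N -> nf_rec m1 w = nf_rec m2 w.
Proof.
elim: m1 m2 w => [|m1 IH] [|m2] [|x w] // s1 s2.
have hw := hat_pos_lt (isT : x :: w != [::]).
rewrite /= /nf_step !(IH m2) //; try by rewrite size_takel ?(ltnW hw) // -ltnS (leq_trans hw).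
all: by rewrite size_drop /= subSS (leq_trans (leq_subr _ _)).
Qed.

Lemma cat_cons_neq0 (L R : seq int) (c : int) : L ++ c :: R != [::].
Proof. by case: L. Qed.

Lemma nf_cat (L R : seq int) (c : int) : above c L -> above c R ->
  nf (L ++ c :: R) =
    if left_first L R then nf L ++ c :: nf R else nf R ++ c :: nf L.
Proof.
move=> aL aR; rewrite {1}/nf size_cat /= addnS.
rewrite /=; case Ew: (L ++ c :: R) (cat_cons_neq0 L R c) => [//|x w] _.
rewrite -{x w}Ew /nf_step wL_cat // wR_cat // hat_cat // /nf.
rewrite (@nf_rec_enough _ (size L) L) ?leq_addr //.
by rewrite (@nf_rec_enough _ (size R) R) ?leq_addl.
Qed.

Lemma above_perm (c : int) (w w' : seq int) : perm_eq w w' -> above c w = above c w'.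
Proof. by move=> p; apply: perm_all. Qed.

Lemma perm_nf (w : seq int) : good w -> perm_eq (nf w) w.
Proof.
move: w; apply: word_ind => // L c R g aL aR pL pR.
rewrite nf_cat //; case: ifP => _; first by rewrite perm_cat // perm_cons.
by rewrite perm_catC /= -cat_cons perm_sym perm_catC /= perm_cons perm_sym perm_catC perm_cat.
Qed.

Lemma minabs_permw (w w' : seq int) : perm_eq w w' -> minabs w = minabs w'.
Proof. by move=> p; apply/minabs_perm/perm_map. Qed.

Lemma perm_eq0 (w w' : seq int) : perm_eq w w' -> (w == [::]) = (w' == [::]).
Proof. by move=> /perm_size s; rewrite -!size_eq0 s. Qed.

Lemma left_first_perm (L L' R R' : seq int) : perm_eq L L' -> perm_eq R R' ->
  left_first L R = left_first L' R'.
Proof.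
move=> pL pR.
by rewrite /left_first (perm_eq0 pL) (perm_eq0 pR) (minabs_permw pL) (minabs_permw pR).
Qed.

Lemma good_minabs_neq (L R : seq int) (c : int) : good (L ++ c :: R) ->
  L != [::] -> R != [::] -> minabs L != minabs R.
Proof.
move=> /andP[u _] /minabs_spec[mL _] /minabs_spec[mR _].
apply/eqP => e; move: u; rewrite map_cat cat_uniq => /and3P[_ /hasPn h _].
have := h (minabs R); rewrite /= in_cons mR orbT => /(_ isT).
by rewrite -e mL.
Qed.

Lemma left_first_swap (L R : seq int) (c : int) : good (L ++ c :: R) ->
  left_first R L = (L == [::]) && (R == [::]) || ~~ left_first L R.
Proof.
move=> g; rewrite /left_first.
case: eqVneq => [->|L0]; case: eqVneq => [->|R0] //=.
by have := good_minabs_neq g L0 R0; lia.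
Qed.

Lemma rev_cat_cons (L R : seq int) (c : int) :
  rev (L ++ c :: R) = rev R ++ c :: rev L.
Proof. by rewrite rev_cat rev_cons cat_rcons. Qed.

Lemma perm_flip_word (k : nat) (w : seq int) : perm_eq (flip_word k w) w.
Proof. by rewrite /flip_word -{3}(cat_take_drop k w) perm_cat // perm_rev. Qed.

(** Reversal swaps the two children of every node, and the normal form forgets their order. *)
Lemma nf_rev (w : seq int) : good w -> nf (rev w) = nf w.
Proof.
move: w; apply: word_ind => // L c R g aL aR IHL IHR.
have pr (s : seq int) : perm_eq (rev s) s by rewrite perm_rev.
rewrite rev_cat_cons !nf_cat //; try by rewrite (above_perm _ (pr _)).
rewrite (left_first_perm (pr R) (pr L)) (left_first_swap g) IHL IHR.
by case: eqVneq => [->|L0]; case: eqVneq => [->|R0] //; case: left_first.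
Qed.

(** A flip of the whole word is a reversal. Any other flip cannot move the minimal letter [c], so it
    is a flip of [L]. *)
Lemma nf_flip (w : seq int) (k : nat) : good w -> (0 < k <= size w)%N ->
  flippable k w -> nf (flip_word k w) = nf w.
Proof.
move=> gw; move: w gw k; apply: word_ind => [[|k]//|L c R g aL aR IHL IHR k kw].
have [->|kn] := eqVneq k (size (L ++ c :: R)).
  by rewrite /flip_word take_size drop_size cats0 nf_rev.
rewrite /flippable (negPf kn) /= => fk.
(* If the prefix contained [c], the letter after it would lie in [R] and be smaller than [c]. *)
have kL : (k <= size L)%N.
  rewrite leqNgt; apply/negP => Lk.
  have /minabs_spec[_ /(_ c)] : take k (L ++ c :: R) != [::].
    by case/andP: kw => k0 kw; rewrite -size_eq0 size_takel // -lt0n.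
  have -> : c \in take k (L ++ c :: R).
    by rewrite take_cat ltnNge (ltnW Lk) /= mem_cat (_ : k - size L = (k - size L).-1.+1)%N ?mem_head ?orbT //; lia.
  move=> /(_ isT) h; move: (leq_trans fk h).
  rewrite nth_cat (ltnNge k) (ltnW Lk) /= (_ : k - size L = (k - size L).-1.+1)%N; last by lia.
  rewrite /= ltnNge ltnW //; apply: (aboveP _ _ aR); apply: mem_nth.
  by move: kw kn; rewrite size_cat /=; lia.
have [gL gR _] := good_cat g.
rewrite /flip_word takel_cat // drop_cat.
have -> : rev (take k L) ++ (if (k < size L)%N then drop k L ++ c :: R
   else drop (k - size L) (c :: R)) = flip_word k L ++ c :: R.
  rewrite /flip_word -catA; case: ltnP => // Lk.
  have -> : k = size L by lia.
  by rewrite subnn drop_size drop0.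
have pf := perm_flip_word k L.
rewrite !nf_cat // ?(above_perm _ pf) // (left_first_perm pf (perm_refl _)) IHL //.
  by case/andP: kw => -> _.
rewrite /flippable; case: eqVneq => //= kL'.
have kL1 : (k < size L)%N by rewrite ltn_neqAle kL' kL.
by move: fk; rewrite nth_cat takel_cat // kL1.
Qed.

(** * Signed maximum and signed peaks read off the tree *)

(** The words [L] and [R] enter only through data that [nf] preserves. *)
Definition smax_comb (c : int) (eL : bool) (mL : nat) (sL : int)
    (eR : bool) (mR : nat) (sR : int) : int :=
  if eL then if eR then c else if 0 < c then c else sR
  else if eR then if 0 < c then c else sL
  else if 0 < c then if (mR < mL)%N then sL else sR
  else if (mL < mR)%N then sL else sR.

Lemma smax_cat (L R : seq int) (c : int) : above c L -> above c R ->
  smax (L ++ c :: R) = smax_comb c (L == [::]) (minabs L) (smax L)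
                                   (R == [::]) (minabs R) (smax R).
Proof.
move=> aL aR; rewrite smaxE ?cat_cons_neq0 // /smax_step wL_cat // wR_cat // hat_cat //.
by case: L {aL} => [|x L]; case: R {aR}.
Qed.

(** The rule for [smax] is symmetric in the two children because their minima differ. *)
Lemma smax_nf (w : seq int) : good w -> smax (nf w) = smax w.
Proof.
move: w; apply: word_ind => // L c R g aL aR IHL IHR.
have [gL gR _] := good_cat g.
have [pL pR] := (perm_nf gL, perm_nf gR).
rewrite nf_cat //; case: ifP => _; rewrite !smax_cat // ?(above_perm _ pL) ?(above_perm _ pR) //;
  rewrite (perm_eq0 pL) (perm_eq0 pR) (minabs_permw pL) (minabs_permw pR) IHL IHR //.
rewrite /smax_comb; case: (eqVneq L [::]) => L0; case: (eqVneq R [::]) => R0 //.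
by have := good_minabs_neq g L0 R0; case: ltngtP.
Qed.

(** The neighbours [a] and [b] of the word are arguments, so that the count can be cut at any
    letter. *)
Fixpoint peaks (a : int) (w : seq int) (b : int) : nat :=
  if w is x :: w' then
    [&& x < 0, (`|a| < `|x|)%N & (`|head b w'| < `|x|)%N] + peaks x w' b
  else 0%N.

Lemma spkE (w : seq int) : spk w = peaks 0 w 0.
Proof.
rewrite /spk.
suff H (a : int) : (let p := a :: rcons w 0 in
    count (fun i => [&& nth 0 p i < 0, (`|nth 0%R p i.-1| < `|nth 0%R p i|)%N
                      & (`|nth 0%R p i.+1| < `|nth 0%R p i|)%N]) (iota 1 (size w)))
    = peaks a w 0 by exact: H.
elim: w a => [//|x w IH] a /=; rewrite -IH; congr (_ + _)%N.
  by case: w {IH}.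
rewrite -[2%N]/(1 + 1)%N iotaDl count_map; apply: eq_in_count => i.
by rewrite mem_iota; case: i.
Qed.

Lemma peaks_cat (a b c : int) (L R : seq int) :
  peaks a (L ++ c :: R) b =
    (peaks a L c + [&& (c < 0)%R, (`|last a L| < `|c|)%N & (`|head b R| < `|c|)%N]
     + peaks c R b)%N.
Proof.
elim: L a => [//|x L IH] a /=; rewrite IH !addnA; congr (_ + _ + _ + _)%N.
by case: L {IH}.
Qed.

Lemma eq_peaks (a a' b b' : int) (w : seq int) :
  above a w -> above a' w -> above b w -> above b' w -> peaks a w b = peaks a' w b'.
Proof.
move=> aw aw' bw bw'; transitivity (peaks a' w b).
  by case: w aw aw' {bw bw'} => //= x w /andP[-> _] /andP[-> _].
elim: w {a aw aw'} a' bw bw' => //= x w IH a' /andP[bx bw] /andP[b'x b'w].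
by rewrite (IH x) //; case: w {IH bw b'w} => //=; rewrite bx b'x.
Qed.

Lemma above0 (w : seq int) : good w -> above 0 w.
Proof.
case/andP=> _ w0; apply/aboveP => x xw; rewrite absz_gt0.
by apply: contraNneq w0 => <-.
Qed.

(** As a neighbour of [L] or [R], the smaller letter [c] acts like the padding 0. It can itself be a
    peak only if both sides are empty. *)
Lemma spk_cat (L R : seq int) (c : int) :
  good (L ++ c :: R) -> above c L -> above c R ->
  spk (L ++ c :: R) = (spk L + spk R + [&& L == [::], R == [::] & (c < 0)%R])%N.
Proof.
move=> g aL aR; have [gL gR c0] := good_cat g.
rewrite !spkE peaks_cat addnAC -(@eq_peaks 0 0 0 c L) ?above0 //.
rewrite -(@eq_peaks 0 c 0 0 R) ?above0 //; congr (_ + _ + nat_of_bool _)%N.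
case/lastP: L {g gL} aL => [_|L x]; last first.
  rewrite /above all_rcons last_rcons => /andP[cx _].
  by rewrite (ltnNge `|x|) (ltnW cx) andbF; case: L.
case: R {gR} aR => [_|x R /andP[cx _]] /=; first by rewrite absz_gt0 c0 !andbT.
by rewrite (ltnNge `|x|) (ltnW cx) !andbF.
Qed.

Lemma spk_nf (w : seq int) : good w -> spk (nf w) = spk w.
Proof.
move: w; apply: word_ind => // L c R g aL aR IHL IHR.
have [gL gR _] := good_cat g.
have [pL pR] := (perm_nf gL, perm_nf gR).
have pw := perm_nf g; move: (good_perm pw); rewrite g.
rewrite nf_cat //; case: ifP => _ g'; rewrite !spk_cat // ?(above_perm _ pL) ?(above_perm _ pR) //;
  rewrite (perm_eq0 pL) (perm_eq0 pR) IHL IHR //.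
by rewrite [(spk R + _)%N]addnC andbCA.
Qed.

(** * Reaching the normal form by flips *)

Inductive flip_reach (w : seq int) : seq int -> Prop :=
| flip_refl : flip_reach w w
| flip_step w' k : flip_reach w w' -> (0 < k <= size w')%N -> flippable k w' ->
    flip_reach w (flip_word k w').

Lemma flip_reach_trans (w1 w2 w3 : seq int) :
  flip_reach w1 w2 -> flip_reach w2 w3 -> flip_reach w1 w3.
Proof. by move=> H; elim=> // w k _ IH kw fk; apply: flip_step. Qed.

Lemma flip_reach_rev (w : seq int) : flip_reach w (rev w).
Proof.
case: (posnP (size w)) => [/size0nil->|w0]; first exact: flip_refl.
have -> : rev w = flip_word (size w) w.
  by rewrite /flip_word take_size drop_size cats0.
apply: flip_step; first exact: flip_refl; first by rewrite w0 leqnn.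
by rewrite /flippable eqxx.
Qed.

Lemma flip_reach_perm (w w' : seq int) : flip_reach w w' -> perm_eq w' w.
Proof.
by elim=> // v k _ IH _ _; apply: perm_trans IH; apply: perm_flip_word.
Qed.

(** A flip of [L] stays legal in the longer word. Even the full reversal of [L] is allowed, since
    the next letter [c] is below all of [L]. *)
Lemma flip_reach_left (L L' R : seq int) (c : int) : above c L ->
  flip_reach L L' -> flip_reach (L ++ c :: R) (L' ++ c :: R).
Proof.
move=> aL; elim=> [|w k Lw IH /andP[k0 kw] fk]; first exact: flip_refl.
have -> : flip_word k w ++ c :: R = flip_word k (w ++ c :: R).
  rewrite /flip_word takel_cat // drop_cat -catA; case: ltnP => // wk.
  have -> : k = size w by lia.
  by rewrite subnn drop_size drop0.
apply: flip_step => //; first by rewrite k0 size_cat; lia.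
apply/orP; right; rewrite nth_cat takel_cat //.
move: fk; rewrite /flippable; case: (eqVneq k (size w)) => [->|kn] /= fk; last first.
  have kw' : (k < size w)%N by rewrite ltn_neqAle kn kw.
  by rewrite kw'.
rewrite ltnn subnn /= take_size above_minabs ?(above_perm _ (flip_reach_perm Lw)) //.
by rewrite -size_eq0 -lt0n; apply: leq_trans k0 kw.
Qed.

Lemma above_rev (c : int) (w : seq int) : above c (rev w) = above c w.
Proof. by apply: above_perm; rewrite perm_rev. Qed.

(** Reverse the whole word, act on what is now the left part, and reverse back. *)
Lemma flip_reach_right (L R R' : seq int) (c : int) : above c R ->
  flip_reach R R' -> flip_reach (L ++ c :: R) (L ++ c :: R').
Proof.
move=> aR RR'; apply: flip_reach_trans (flip_reach_rev _) _.
rewrite rev_cat_cons; apply: (flip_reach_trans (w2 := rev R' ++ c :: rev L)).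
  apply: flip_reach_left; first by rewrite above_rev.
  apply: flip_reach_trans (flip_reach_rev _) _; rewrite revK.
  exact: flip_reach_trans RR' (flip_reach_rev _).
by have := flip_reach_rev (rev R' ++ c :: rev L); rewrite rev_cat_cons !revK.
Qed.

Lemma flip_reach_nf (w : seq int) : good w -> flip_reach w (nf w).
Proof.
move: w; apply: word_ind => [|L c R g aL aR IHL IHR]; first exact: flip_refl.
have [gL gR _] := good_cat g.
have [pL pR] := (perm_nf gL, perm_nf gR).
have H : flip_reach (L ++ c :: R) (nf L ++ c :: nf R).
  apply: flip_reach_trans (flip_reach_left R aL IHL) _.
  exact: flip_reach_right.
rewrite nf_cat //; case: ifP => // _.
apply: flip_reach_trans H _; apply: flip_reach_trans (flip_reach_rev _) _.
have unrev s : flip_reach (rev s) s.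
  by have := flip_reach_rev (rev s); rewrite revK.
rewrite rev_cat_cons; apply: flip_reach_trans (flip_reach_left _ _ (unrev _)) _.
  by rewrite above_rev (above_perm _ pR).
apply: flip_reach_right (unrev _).
by rewrite above_rev (above_perm _ pL).
Qed.

(** * Ordered splittings and the list of normal words *)

Fixpoint splits (s : seq nat) : seq (seq nat * seq nat) :=
  if s is a :: s' then
    [seq (a :: AB.1, AB.2) | AB <- splits s'] ++
    [seq (AB.1, a :: AB.2) | AB <- splits s']
  else [:: ([::], [::])].

(** For increasing [s], the least letter is forced into the first part. Each unordered splitting
    then occurs once, ordered as [left_first] requires. *)
Definition head_left_splits (s : seq nat) : seq (seq nat * seq nat) :=
  if s is a :: s' then [seq (a :: AB.1, AB.2) | AB <- splits s']
  else [:: ([::], [::])].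

Lemma head_left_sub (s : seq nat) : {subset head_left_splits s <= splits s}.
Proof. by case: s => // a s x xs; rewrite /= mem_cat xs. Qed.

Lemma splits_subseq (s A B : seq nat) : (A, B) \in splits s ->
  [/\ subseq A s, subseq B s & perm_eq (A ++ B) s].
Proof.
elim: s A B => [|a s IH] A B /=; first by rewrite inE => /eqP[-> ->].
rewrite mem_cat => /orP[]/mapP[[A' B'] /IH[sA sB p] [-> ->]].
  split; [by rewrite /= eqxx|exact: subseq_trans sB (subseq_cons _ _)|].
  by rewrite /= perm_cons.
split; [exact: subseq_trans sA (subseq_cons _ _)|by rewrite /= eqxx|].
by rewrite -cat1s perm_catCA /= perm_cons.
Qed.

Lemma splits_filter (p : pred nat) (s : seq nat) :
  (filter p s, filter (predC p) s) \in splits s.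
Proof.
elim: s => [//|a s IH]; rewrite [splits _]/= mem_cat /=.
by case: (p a) => /=; apply/orP; [left|right]; apply/mapP; exists (filter p s, filter (predC p) s).
Qed.

Lemma uniq_splits (s : seq nat) : uniq s -> uniq (splits s).
Proof.
elim: s => [//|a s IH] /= /andP[as_ us]; rewrite cat_uniq.
rewrite !map_inj_uniq ?IH //; [|by move=> [? ?] [? ?] [-> ->]..].
rewrite andbT; apply/hasPn => _ /mapP[[A B] /splits_subseq[sA _ _] ->].
apply/mapP => -[[A' B'] _ /= [e _]].
by rewrite (mem_subseq sA) // e mem_head in as_.
Qed.

Lemma uniq_head_left (s : seq nat) : uniq s -> uniq (head_left_splits s).
Proof.
case: s => [//|a s] /= /andP[_ us].
by rewrite map_inj_uniq ?uniq_splits // => -[? ?] [? ?] [-> ->].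
Qed.

Lemma absz_eqE (a : nat) (c : int) :
  reflect (`|c|%N = a) ((c == a%:Z) || (c == - a%:Z)).
Proof.
by apply: (iffP orP) => [[]/eqP->|<-]; rewrite ?abszN //; lia.
Qed.

Definition glue (p : (seq int * seq int) * int) : seq int := p.1.1 ++ p.2 :: p.1.2.

Definition pieces (rec : seq nat -> seq (seq int)) (a : nat) (s : seq nat) :
    seq ((seq int * seq int) * int) :=
  [seq x | AB <- head_left_splits s,
           x <- [seq (LR, c) | LR <- [seq (L, R) | L <- rec AB.1, R <- rec AB.2],
                               c <- [:: a%:Z; - a%:Z]]].

Fixpoint words_rec (m : nat) (s : seq nat) : seq (seq int) :=
  if m is m'.+1 then
    if s is a :: s' then map glue (pieces (words_rec m') a s') else [:: [::]]
  else [:: [::]].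

(* The words with prescribed absolute values s that are fixed by nf. *)
Definition words (s : seq nat) : seq (seq int) := words_rec (size s) s.

Lemma eq_pieces (f g : seq nat -> seq (seq int)) (a : nat) (s : seq nat) :
  (forall A, subseq A s -> f A = g A) -> pieces f a s = pieces g a s.
Proof.
move=> fg; rewrite /pieces; congr flatten; apply/eq_in_map => -[A B] /head_left_sub.
by case/splits_subseq => sA sB _; rewrite !fg.
Qed.

Lemma words_rec_enough (m1 m2 : nat) (s : seq nat) :
  (size s <= m1)%N -> (size s <= m2)%N -> words_rec m1 s = words_rec m2 s.
Proof.
elim: m1 m2 s => [|m1 IH] [|m2] [|a s] //= s1 s2.
by congr map; apply: eq_pieces => A /size_subseq sA; apply: IH; apply: leq_trans sA _.
Qed.

Lemma words_cons (a : nat) (s : seq nat) :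
  words (a :: s) = map glue (pieces words a s).
Proof.
rewrite /words /=; congr map; apply: eq_pieces => A /size_subseq sA.
exact: words_rec_enough.
Qed.

Lemma mem_pieces (f : seq nat -> seq (seq int)) (a : nat) (s : seq nat) p :
  reflect (exists A B, [/\ (A, B) \in head_left_splits s, p.1.1 \in f A, p.1.2 \in f B
                     & (p.2 == a%:Z) || (p.2 == - a%:Z)])
          (p \in pieces f a s).
Proof.
case: p => [[L R] c]; apply: (iffP idP) => /= [/allpairsPdep[[A B] [x [AB xf e]]]|[A [B [AB Lf Rf ca]]]].
  move: xf; rewrite -e => /allpairsP[[LR c'] /= [/allpairsP[[L' R'] /= [L1 R1 ->]] c1 [-> -> ->]]].
  by exists A, B; split=> //; move: c1; rewrite !inE.
apply/allpairsPdep; exists (A, B), ((L, R), c); split=> //.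
apply/allpairsP; exists ((L, R), c); rewrite !inE; split=> //=.
by apply/allpairsP; exists (L, R).
Qed.

Lemma path_above (c : int) (s : seq nat) (w : seq int) :
  path ltn `|c|%N s -> perm_eq (map absz w) s -> above c w.
Proof.
move=> /(order_path_min ltn_trans)/allP h p; apply/aboveP => x xw; apply: h.
by rewrite -(perm_mem p) map_f.
Qed.

Lemma path_ltn_subseq (a : nat) (A s : seq nat) :
  subseq A s -> path ltn a s -> path ltn a A.
Proof. by apply: subseq_path => ? ? ?; apply: ltn_trans. Qed.

Lemma path_ltn0 (a : nat) (s : seq nat) : path ltn a s -> path ltn 0 s.
Proof. by case: s => //= b s /andP[ab ->]; rewrite (leq_ltn_trans _ ab). Qed.

Lemma path_good (s : seq nat) (w : seq int) :
  path ltn 0 s -> perm_eq (map absz w) s -> good w.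
Proof.
move=> ps p; rewrite /good (perm_uniq p).
rewrite (sorted_uniq ltn_trans ltnn (path_sorted ps)) /=.
have := path_above (c := 0) ps p.
by apply: contraTN => w0; apply/aboveP => /(_ _ w0).
Qed.

Lemma perm_absz_glue (L R : seq int) (c : int) (A B s : seq nat) :
  perm_eq (map absz L) A -> perm_eq (map absz R) B -> perm_eq (A ++ B) s ->
  perm_eq (map absz (L ++ c :: R)) (`|c|%N :: s).
Proof.
move=> pL pR ps; rewrite map_cat /= -cat1s perm_catCA /= perm_cons.
exact: perm_trans (perm_cat pL pR) ps.
Qed.

Lemma head_left_first (A B s : seq nat) (L R : seq int) : sorted ltn s ->
  (A, B) \in head_left_splits s -> perm_eq (map absz L) A -> perm_eq (map absz R) B ->
  left_first L R.
Proof.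
case: s => [|b s] /= ps; first by rewrite inE => /eqP[-> ->]; move=> _ /perm_size; case: R.
case/mapP=> -[A' B'] /splits_subseq[sA sB _] /= [-> ->] pL pR.
rewrite /left_first; case: eqVneq => //= R0.
have [x xL bx] : exists2 x, x \in L & b = `|x|%N.
  by apply/mapP; rewrite (perm_mem pL) mem_head.
have L0 : L != [::] by case: L xL {pL}.
rewrite L0 /=; apply: (leq_ltn_trans (n := b)).
  by rewrite bx; have [_ ->] := minabs_spec L0.
have [+ _] := minabs_spec R0; rewrite (perm_mem pR) => /(mem_subseq sB).
exact: (allP (order_path_min ltn_trans ps)).
Qed.

Lemma words_sound (s : seq nat) (w : seq int) : path ltn 0 s -> w \in words s ->
  perm_eq (map absz w) s /\ nf w = w.
Proof.
have [m] := ubnP (size s); elim: m s w => // m IH [|a s] w sm ps.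
  by rewrite inE => /eqP->.
rewrite words_cons => /mapP[[[L R] c] /mem_pieces[A [B [AB /= Lw Rw ca]]] ->].
move/absz_eqE: ca => ca.
have [sA sB pAB] := splits_subseq (head_left_sub AB).
have /= /andP[_ psa] := ps; have ps0 := path_ltn0 psa.
have [|pL nL] := IH _ _ _ (path_ltn_subseq sA ps0) Lw.
  exact: leq_ltn_trans (size_subseq sA) sm.
have [|pR nR] := IH _ _ _ (path_ltn_subseq sB ps0) Rw.
  exact: leq_ltn_trans (size_subseq sB) sm.
rewrite /glue /= -ca; split; first exact: perm_absz_glue pAB.
rewrite nf_cat ?nL ?nR.
- by rewrite (head_left_first (path_sorted psa) AB pL pR).
- by apply: path_above pL; rewrite ca (path_ltn_subseq sA).
- by apply: path_above pR; rewrite ca (path_ltn_subseq sB).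
Qed.

Lemma head_left_exists (L R : seq int) (s : seq nat) : sorted ltn s ->
  perm_eq (map absz (L ++ R)) s -> left_first L R ->
  exists A B, [/\ (A, B) \in head_left_splits s, perm_eq (map absz L) A
                & perm_eq (map absz R) B].
Proof.
move=> ss ps lf; pose p := [in map absz L].
have us : uniq s := sorted_uniq ltn_trans ltnn ss.
move: (us); rewrite -(perm_uniq ps) map_cat cat_uniq => /and3P[uL /hasPn dLR uR].
have ms x : (x \in s) = (x \in map absz L) || (x \in map absz R).
  by rewrite -(perm_mem ps) map_cat mem_cat.
exists (filter p s), (filter (predC p) s); split.
- case: s ss us ms {ps} => //= b s ss /andP[bs us] ms.
  (* Otherwise [b], the least letter, comes from [R], and [minabs R <= b < minabs L] contradicts
     [left_first]. *)
  have pb : p b.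
    have := ms b; rewrite mem_head => /esym/orP[//|bR].
    case/orP: lf => [/eqP R0|/andP[L0 lLR]]; first by rewrite R0 in bR.
    have [mL _] := minabs_spec L0.
    have : minabs L \in b :: s by rewrite ms mL.
    rewrite inE => /predU1P[<- //|/(allP (order_path_min ltn_trans ss)) bL].
    case/mapP: bR => x xR bx.
    have R0 : R != [::] by case: R xR {dLR uR ms lLR}.
    have [_ /(_ x xR)] := minabs_spec R0.
    by move: bL; rewrite /= bx; lia.
  rewrite pb /=; apply/mapP; exists (filter p s, filter (predC p) s) => //.
  exact: splits_filter.
- apply: uniq_perm => //; first exact: filter_uniq.
  by move=> x; rewrite mem_filter ms /p /=; case: (x \in _).
- apply: uniq_perm => //; first exact: filter_uniq.
  move=> x; rewrite mem_filter ms /p /=.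
  have := dLR x; rewrite /=.
  by case: (x \in map absz L); case: (x \in map absz R) => // /(_ isT).
Qed.

Lemma words_complete (w : seq int) (s : seq nat) : path ltn 0 s ->
  perm_eq (map absz w) s -> nf w \in words s.
Proof.
move=> ps pw; have gw := path_good ps pw; move: w gw s ps pw.
apply: word_ind => [s _ /perm_size|L c R g aL aR IHL IHR s ps pw].
  by case: s.
have cs : `|c|%N \in s by rewrite -(perm_mem pw) map_f // mem_cat mem_head orbT.
case: s cs ps pw => // a s cs /= /andP[_ ps] pw.
have ca : `|c|%N = a.
  apply/eqP; rewrite eqn_leq; apply/andP; split; last first.
    by move: cs; rewrite inE => /predU1P[-> //|/(allP (order_path_min ltn_trans ps))/ltnW].
  have : a \in map absz (L ++ c :: R) by rewrite (perm_mem pw) mem_head.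
  case/mapP=> x; rewrite mem_cat inE => /or3P[xL|/eqP->|xR] -> //; apply: ltnW.
    exact: (aboveP _ _ aL).
  exact: (aboveP _ _ aR).
have pLR : perm_eq (map absz (L ++ R)) s.
  rewrite -(perm_cons a) -{1}ca; apply: perm_trans pw.
  by rewrite perm_sym map_cat /= -cat1s perm_catCA /= map_cat.
have ps0 := path_ltn0 ps.
have key U W : left_first U W -> perm_eq (map absz (U ++ W)) s ->
    (forall A, path ltn 0 A -> perm_eq (map absz U) A -> nf U \in words A) ->
    (forall A, path ltn 0 A -> perm_eq (map absz W) A -> nf W \in words A) ->
    nf U ++ c :: nf W \in words (a :: s).
  move=> lf pUW IHU IHW.
  have [A [B [AB pU pW]]] := head_left_exists (path_sorted ps) pUW lf.
  have [sA sB _] := splits_subseq (head_left_sub AB).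
  rewrite words_cons; apply/mapP; exists ((nf U, nf W), c) => //.
  apply/mem_pieces; exists A, B; split=> //=.
  - by apply: IHU; rewrite // (path_ltn_subseq sA).
  - by apply: IHW; rewrite // (path_ltn_subseq sB).
  - exact/absz_eqE.
rewrite nf_cat //; case: ifP => lf; first exact: key.
apply: key => //; first by rewrite (left_first_swap g) lf orbT.
by apply: perm_trans pLR; apply: perm_map; rewrite perm_catC.
Qed.

Lemma uniq_flatten_key (S T : eqType) (k : T -> S) (s : seq S) (t : S -> seq T) :
  uniq s -> (forall x, x \in s -> uniq (t x)) ->
  (forall x y, x \in s -> y \in t x -> k y = x) ->
  uniq [seq y | x <- s, y <- t x].
Proof.
elim: s => //= x s IH /andP[xs us] ut kt; rewrite map_id cat_uniq ut ?mem_head //=.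
rewrite IH //; first last.
- by move=> y z ys; apply: kt; rewrite inE ys orbT.
- by move=> y ys; apply: ut; rewrite inE ys orbT.
rewrite andbT; apply/hasPn => _ /allpairsPdep[y [z [ys zt ->]]].
apply: contra xs => zx; rewrite -(kt x z) ?mem_head // (kt y z) //.
by rewrite inE ys orbT.
Qed.

Lemma perm_sort_leq (s1 s2 : seq nat) : perm_eq s1 s2 -> sort leq s1 = sort leq s2.
Proof. by move/(perm_sortP leq_total leq_trans anti_leq). Qed.

Lemma uniq_words (s : seq nat) : path ltn 0 s -> uniq (words s).
Proof.
have [m] := ubnP (size s); elim: m s => // m IH [|a s] sm ps //.
have /= /andP[a0 psa] := ps; have ps0 := path_ltn0 psa.
have us : uniq s := sorted_uniq ltn_trans ltnn (path_sorted psa).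
have facts A B p : (A, B) \in head_left_splits s -> p.1.1 \in words A ->
    p.1.2 \in words B -> (p.2 == a%:Z) || (p.2 == - a%:Z) ->
    [/\ perm_eq (map absz p.1.1) A, perm_eq (map absz p.1.2) B,
        above p.2 p.1.1 & above p.2 p.1.2].
  move=> AB Lw Rw ca; have [sA sB _] := splits_subseq (head_left_sub AB).
  move/absz_eqE: ca => ca.
  have [pL _] := words_sound (path_ltn_subseq sA ps0) Lw.
  have [pR _] := words_sound (path_ltn_subseq sB ps0) Rw.
  split=> //; [apply: path_above pL|apply: path_above pR].
    by rewrite ca (path_ltn_subseq sA).
  by rewrite ca (path_ltn_subseq sB).
rewrite words_cons map_inj_in_uniq; last first.
  move=> p p' /mem_pieces[A [B [AB Lw Rw ca]]] /mem_pieces[A' [B' [AB' Lw' Rw' ca']]].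
  have [_ _ aL aR] := facts _ _ _ AB Lw Rw ca.
  have [_ _ aL' aR'] := facts _ _ _ AB' Lw' Rw' ca'.
  case: p p' aL aR aL' aR' {Lw Rw ca Lw' Rw' ca'} => [[L R] c] [[L' R'] c'].
  rewrite /glue /= => aL aR aL' aR' e.
  by rewrite -(wL_cat aL aR) -{2}(wR_cat aL aR) -{3}(hat_cat aL aR) e
    wL_cat // wR_cat // hat_cat.
have sub A B : (A, B) \in head_left_splits s -> uniq (words A) /\ uniq (words B).
  move=> /head_left_sub/splits_subseq[sA sB _].
  split; apply: IH; rewrite ?(path_ltn_subseq sA) ?(path_ltn_subseq sB) //.
    exact: leq_ltn_trans (size_subseq sA) sm.
  exact: leq_ltn_trans (size_subseq sB) sm.
(* Sorting the absolute values of the two subwords recovers the splitting they came from. *)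
apply: (@uniq_flatten_key _ _ (fun p => (sort leq (map absz p.1.1), sort leq (map absz p.1.2)))).
- exact: uniq_head_left.
- move=> [A B] /sub[uA uB]; rewrite allpairs_uniq //.
  + by rewrite allpairs_uniq // => -[? ?] [? ?] _ _ [-> ->].
  + by rewrite /= inE andbT; lia.
  + by move=> [? ?] [? ?] _ _ [-> ->].
move=> [A B] p AB; have [sA sB _] := splits_subseq (head_left_sub AB).
case/allpairsP => -[LR c] /= [/allpairsP[[L R] /= [Lw Rw ->]] ca ->].
have [|pL pR _ _] := facts _ _ ((L, R), c) AB Lw Rw; first by rewrite !inE in ca.
have srt D : subseq D s -> sort leq D = D.
  move=> sD; apply: sorted_sort; first exact: leq_trans.
  by apply: (sub_sorted ltnW); apply: path_sorted (path_ltn_subseq sD psa).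
by rewrite /= (perm_sort_leq pL) (perm_sort_leq pR) !srt.
Qed.

Lemma head_left_words (a : nat) (c : int) (s A B : seq nat) (L R : seq int) :
  path ltn 0 (a :: s) -> (A, B) \in head_left_splits s ->
  L \in words A -> R \in words B -> `|c|%N = a ->
  [/\ above c L, above c R, good (L ++ c :: R) & left_first L R].
Proof.
move=> /= /andP[a0 psa] AB Lw Rw ca; have ps0 := path_ltn0 psa.
have [sA sB pAB] := splits_subseq (head_left_sub AB).
have [pL _] := words_sound (path_ltn_subseq sA ps0) Lw.
have [pR _] := words_sound (path_ltn_subseq sB ps0) Rw.
split.
- by apply: path_above pL; rewrite ca (path_ltn_subseq sA).
- by apply: path_above pR; rewrite ca (path_ltn_subseq sB).
- apply: (path_good (s := a :: s)); first by rewrite /= a0.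
  by rewrite -ca; apply: perm_absz_glue pAB.
exact: head_left_first (path_sorted psa) AB pL pR.
Qed.

Lemma words_eq0 (s : seq nat) (w : seq int) :
  path ltn 0 s -> w \in words s -> (w == [::]) = (s == [::]).
Proof.
by move=> ps /(words_sound ps)[/perm_size p _]; rewrite -!size_eq0 -p size_map.
Qed.

Lemma smax_mem (w : seq int) : good w -> w != [::] -> smax w \in w.
Proof.
move: w; apply: word_ind => // L c R _ aL aR IHL IHR _.
rewrite smax_cat // /smax_comb mem_cat inE.
case: eqVneq IHL => [_ _|_ /(_ isT) sL]; case: eqVneq IHR => [_ _|_ /(_ isT) sR];
  rewrite ?eqxx ?orbT //; repeat case: ifP => _; by rewrite ?sL ?sR ?eqxx ?orbT.
Qed.

(** * Weighted sums over normal words, expanded at the root *)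

Section WeightedSums.
Context {K : comNzRingType} (u : K).

Definition total (s : seq nat) : K := \sum_(w <- words s) u ^+ spk w.

Definition smax_total (x : int) (s : seq nat) : K :=
  \sum_(w <- words s) (smax w == x)%:R * u ^+ spk w.

Lemma total_nil : total [::] = 1.
Proof. by rewrite /total big_seq1. Qed.

Lemma smax_total_nil (x : int) : x != 0 -> smax_total x [::] = 0.
Proof. by move=> x0; rewrite /smax_total big_seq1 eq_sym (negPf x0) mul0r. Qed.

Lemma sum_words_cons (a : nat) (s : seq nat) (g : seq int -> K) :
  \sum_(w <- words (a :: s)) g w =
  \sum_(AB <- head_left_splits s) \sum_(L <- words AB.1) \sum_(R <- words AB.2)
    (g (L ++ a%:Z :: R) + g (L ++ - a%:Z :: R)).
Proof.
rewrite words_cons big_map /pieces big_allpairs_dep; apply: eq_bigr => AB _.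
rewrite !big_allpairs_dep; apply: eq_bigr => L _.
by apply: eq_bigr => R _; rewrite big_cons big_seq1.
Qed.

Lemma sum_mul (A B : seq nat) (f g : seq int -> K) :
  \sum_(L <- words A) \sum_(R <- words B) f L * g R =
  (\sum_(L <- words A) f L) * (\sum_(R <- words B) g R).
Proof. by rewrite big_distrl; apply: eq_bigr => L _; rewrite big_distrr. Qed.

Lemma total1 (a : nat) : (0 < a)%N -> total [:: a] = 1 + u.
Proof.
move=> a0; rewrite /total sum_words_cons !big_seq1.
by congr (_ + _); rewrite spkE /= ?absz0; case: a a0 => // a _; rewrite ?expr1 ?expr0.
Qed.

Lemma smax_total1 (a : nat) (x : int) : (0 < a)%N ->
  smax_total x [:: a] = (x == a%:Z)%:R + (x == - a%:Z)%:R * u.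
Proof.
move=> a0; rewrite /smax_total sum_words_cons !big_seq1 ![_ == x]eq_sym.
have E c : smax [:: c] = c by rewrite -[[:: c]]/([::] ++ c :: [::]) smax_cat.
by rewrite /= !E !spkE /=; case: a a0 => // a _; rewrite ?expr1 ?expr0 ?mulr1.
Qed.

Lemma sum_splits_swap (s : seq nat) (F : seq nat -> seq nat -> K) :
  \sum_(AB <- splits s) F AB.1 AB.2 = \sum_(AB <- splits s) F AB.2 AB.1.
Proof.
elim: s F => [|a s IH] F /=; first by rewrite !big_seq1.
rewrite !big_cat !big_map /= addrC; congr (_ + _).
  by rewrite (IH (fun A B => F A (a :: B))).
by rewrite (IH (fun A B => F (a :: A) B)).
Qed.

Lemma sum_head_left_splits (a : nat) (s : seq nat) (F : seq nat -> seq nat -> K) :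
  \sum_(AB <- head_left_splits (a :: s)) (F AB.1 AB.2 + F AB.2 AB.1) =
  \sum_(AB <- splits (a :: s)) F AB.1 AB.2.
Proof.
rewrite /= big_cat !big_map /= big_split /=; congr (_ + _).
by rewrite (sum_splits_swap _ (fun A B => F B (a :: A))).
Qed.

Lemma head_left_neq0 (a : nat) (s : seq nat) AB :
  AB \in head_left_splits (a :: s) -> AB.1 != [::].
Proof. by case/mapP=> AB' _ ->. Qed.

(** The root has a child, so neither of its signs makes a peak. The resulting factor 2 turns
    unordered splittings into ordered ones. *)
Lemma total_cons (a b : nat) (s : seq nat) : path ltn 0 (a :: b :: s) ->
  total (a :: b :: s) = \sum_(AB <- splits (b :: s)) total AB.1 * total AB.2.
Proof.
move=> ps; rewrite -(sum_head_left_splits _ _ (fun A B => total A * total B)) /total sum_words_cons.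
apply: eq_big_seq => -[A B] AB; rewrite [(A, B).1]/= [(A, B).2]/=.
rewrite [X in _ + X]mulrC -mulr2n -sum_mul -sumrMnl; apply: eq_big_seq => L Lw.
rewrite -sumrMnl; apply: eq_big_seq => R Rw.
have [//|aL aR g _] := head_left_words (c := a%:Z) ps AB Lw Rw.
have [|aL' aR' g' _] := head_left_words (c := - a%:Z) ps AB Lw Rw; first by rewrite abszN.
have L0 : L != [::].
  have [sA _ _] := splits_subseq (head_left_sub AB).
  have /andP[_ psa] : (0 < a)%N && path ltn a (b :: s) := ps.
  rewrite (words_eq0 _ Lw); first exact: head_left_neq0 AB.
  exact: path_ltn_subseq sA (path_ltn0 psa).
by rewrite !spk_cat // (negPf L0) addn0 exprD mulr2n.
Qed.

Lemma smax_total_cons (x : int) (a b : nat) (s : seq nat) : x != 0 ->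
  path ltn 0 (a :: b :: s) ->
  smax_total x (a :: b :: s) = (x == a%:Z)%:R * total (b :: s) +
    \sum_(AB <- splits (b :: s)) smax_total x AB.1 * total AB.2.
Proof.
move=> x0 ps.
rewrite -(sum_head_left_splits _ _ (fun A B => smax_total x A * total B)) {1}/smax_total sum_words_cons.
(* The root is the signed maximum only when it is positive with a single child, so this term is
   spread over the splittings and supported on an empty second part. *)
have -> : (x == a%:Z)%:R * total (b :: s) =
    \sum_(AB <- head_left_splits (b :: s)) (AB.2 == [::])%:R * (x == a%:Z)%:R * total AB.1.
  have H s' : forall F : seq nat -> K,
      \sum_(AB <- splits s') (AB.2 == [::])%:R * F AB.1 = F s'.
    elim: s' => [|d s' IH] F; first by rewrite big_seq1 mul1r.
    rewrite big_cat !big_map /= (IH (fun A => F (d :: A))) big1 ?addr0 // => AB _.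
    by rewrite mul0r.
  rewrite big_map -(H s (fun A => (x == a%:Z)%:R * total (b :: A))).
  by apply: eq_bigr => AB _; rewrite mulrA.
rewrite -big_split; apply: eq_big_seq => -[A B] AB; rewrite [(A, B).1]/= [(A, B).2]/=.
have [sA sB _] := splits_subseq (head_left_sub AB).
have /andP[a0 psa] : (0 < a)%N && path ltn a (b :: s) := ps.
have ps0 := path_ltn0 psa.
have A0 := head_left_neq0 AB.
transitivity (\sum_(L <- words A) \sum_(R <- words B)
   ((B == [::])%:R * (x == a%:Z)%:R * (u ^+ spk L * u ^+ spk R)
    + ((smax L == x)%:R * u ^+ spk L * u ^+ spk R +
       u ^+ spk L * ((smax R == x)%:R * u ^+ spk R)))).
  apply: eq_big_seq => L Lw; apply: eq_big_seq => R Rw.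
  have [//|aL aR g lf] := head_left_words (c := a%:Z) ps AB Lw Rw.
  have [|aL' aR' g' _] := head_left_words (c := - a%:Z) ps AB Lw Rw; first by rewrite abszN.
  have L0 : L != [::] by rewrite (words_eq0 _ Lw) // (path_ltn_subseq sA).
  have RB := words_eq0 (path_ltn_subseq sB ps0) Rw.
  rewrite !spk_cat // !smax_cat // (negPf L0) addn0 exprD /smax_comb RB.
  have -> : 0 < a%:Z by [].
  have -> : (0 < - a%:Z) = false by rewrite oppr_gt0 ltNge.
  (* With a single child, [a] stops at the root and [- a] continues into [L]. With two,
     [minabs L < minabs R], so [a] selects [R] and [- a] selects [L]. *)
  move: lf; rewrite /left_first RB L0 /=; case: eqVneq => [B0 _|_ /= lt].
    have -> : R = [::] by apply/eqP; rewrite RB B0.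
    have -> : (smax [::] == x) = false by rewrite eq_sym (negPf x0).
    by rewrite [x == _]eq_sym /= mulr1n mulr0n; ring.
  by rewrite lt (ltnNge _ (minabs L)) (ltnW lt) /=; ring.
transitivity ((B == [::])%:R * (x == a%:Z)%:R * (total A * total B) +
    (smax_total x A * total B + total A * smax_total x B)).
  rewrite /total /smax_total -!sum_mul big_distrr /= -!big_split /=.
  by apply: eq_bigr => L _; rewrite big_distrr /= -!big_split.
case: eqVneq => [->|_]; last by rewrite /= mulr0n; ring.
by rewrite total_nil smax_total_nil //=; ring.
Qed.

(* spl_sum n F is the sum of F #|A| #|B| over the ordered splittings of an     *)
(* n-element set into two parts A and B.                                      *)
Fixpoint spl_sum (n : nat) (F : nat -> nat -> K) : K :=
  if n is n'.+1 then spl_sum n' (fun i j => F i.+1 j + F i j.+1) else F 0%N 0%N.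

Lemma sum_splits_size (s : seq nat) (F : seq nat -> seq nat -> K) (G : nat -> nat -> K) :
  (forall A B, subseq A s -> subseq B s -> F A B = G (size A) (size B)) ->
  \sum_(AB <- splits s) F AB.1 AB.2 = spl_sum (size s) G.
Proof.
elim: s F G => [|a s IH] F G FG /=; first by rewrite big_seq1 FG.
rewrite big_cat !big_map /= -big_split /=.
apply: (IH (fun A B => F (a :: A) B + F A (a :: B))) => A B sA sB.
have ss D : subseq D s -> subseq D (a :: s).
  by move=> sD; apply: subseq_trans sD (subseq_cons _ _).
by rewrite !FG /= ?eqxx //; apply: ss.
Qed.

Lemma eq_spl_sum (n : nat) (F G : nat -> nat -> K) :
  (forall i j, (i + j)%N = n -> F i j = G i j) -> spl_sum n F = spl_sum n G.
Proof.
elim: n F G => [|n IH] F G FG /=; first exact: FG.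
by apply: IH => i j ij; rewrite !FG -?ij ?addSn ?addnS.
Qed.

Lemma spl_sumD (n : nat) (F G : nat -> nat -> K) :
  spl_sum n (fun i j => F i j + G i j) = spl_sum n F + spl_sum n G.
Proof.
elim: n F G => [//|n IH] F G /=; rewrite -IH; apply: eq_spl_sum => i j _; ring.
Qed.

Lemma spl_sumZ (n : nat) (c : K) (F : nat -> nat -> K) :
  spl_sum n (fun i j => c * F i j) = c * spl_sum n F.
Proof.
elim: n F => [//|n IH] F /=; rewrite -IH; apply: eq_spl_sum => i j _; ring.
Qed.

Lemma spl_sum_left0 (n : nat) (F : nat -> nat -> K) :
  spl_sum n (fun i j => (i == 0%N)%:R * F i j) = F 0%N n.
Proof.
elim: n F => [|n IH] F /=; first by rewrite mul1r.
rewrite -(IH (fun i j => F i j.+1)); apply: eq_spl_sum => i j _.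
by rewrite mul0r add0r.
Qed.

(** * The sums depend only on the numbers of letters *)

Definition tot (n : nat) : K := total (iota 1 n).

Lemma path_iota (n : nat) : path ltn 0 (iota 1 n).
Proof. exact: (iota_ltn_sorted 0 n.+1). Qed.

Lemma path_ltn_behead (a : nat) (s : seq nat) : path ltn 0 (a :: s) -> path ltn 0 s.
Proof. by move=> /= /andP[_]; exact: path_ltn0. Qed.

Lemma total_size (s : seq nat) : path ltn 0 s -> total s = tot (size s).
Proof.
have [m] := ubnP (size s); elim: m s => // m IH [|a [|b s]] sm ps //.
  by rewrite /tot !total1 //; case/andP: ps.
have step a' b' s' : size s' = size s -> path ltn 0 [:: a', b' & s'] ->
    total [:: a', b' & s'] = spl_sum (size s).+1 (fun i j => tot i * tot j).
  move=> ss ps'; have ps0 := path_ltn_behead ps'; rewrite total_cons //.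
  rewrite -ss; apply: sum_splits_size (fun A B => total A * total B) _ _ => A B sA sB.
  by rewrite !IH ?(path_ltn_subseq sA) ?(path_ltn_subseq sB) //;
    apply: leq_ltn_trans (size_subseq _) _; first [exact: sA|exact: sB|rewrite /= ss].
rewrite step // /tot /= step ?size_iota //; exact: (path_iota (size s).+2).
Qed.

Lemma tot0 : tot 0 = 1. Proof. exact: total_nil. Qed.

Lemma tot1 : tot 1 = 1 + u. Proof. exact: total1. Qed.

Lemma tot_SS (n : nat) : tot n.+2 = spl_sum n.+1 (fun i j => tot i * tot j).
Proof.
rewrite {1}/tot /= total_cons; last exact: (path_iota n.+2).
have ps : path ltn 0 (2%N :: iota 3 n) := path_ltn_behead (path_iota n.+2).
rewrite (@sum_splits_size _ (fun A B => total A * total B) (fun i j => tot i * tot j))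
  => [|A B sA sB]; first by rewrite /= size_iota.
by rewrite !total_size //; [exact: path_ltn_subseq sB ps|exact: path_ltn_subseq sA ps].
Qed.

(** The correction at n = 0 is the negative sign of a one-letter word, which is a peak. *)
Lemma tot_S (n : nat) : tot n.+1 = spl_sum n (fun i j => tot i * tot j) + (n == 0%N)%:R * u.
Proof.
case: n => [|n]; first by rewrite tot1 /= tot0; ring.
by rewrite tot_SS mul0r addr0.
Qed.

Definition sgz_of (e : bool) (y : nat) : int := if e then y%:Z else - y%:Z.

(* The sum over normal words in which the signed maximum has sign e, p smaller *)
(* letters and r larger ones.                                                  *)
Definition phi (e : bool) (p r : nat) : K :=
  smax_total (sgz_of e p.+1) (iota 1 (p + r.+1)).

Lemma sgz_of_eq0 (e : bool) (y : nat) : (sgz_of e y == 0) = (y == 0%N).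
Proof. by case: e; rewrite /sgz_of ?oppr_eq0. Qed.

Lemma absz_sgz_of (e : bool) (y : nat) : `|sgz_of e y|%N = y.
Proof. by case: e; rewrite /sgz_of ?abszN. Qed.

Lemma sum_splits_cat (s1 s2 : seq nat) (y : nat) (F : seq nat -> seq nat -> K) :
  \sum_(AB <- splits (s1 ++ y :: s2)) F AB.1 AB.2 =
  \sum_(AB <- splits s1) \sum_(CD <- splits s2)
    (F (AB.1 ++ y :: CD.1) (AB.2 ++ CD.2) + F (AB.1 ++ CD.1) (AB.2 ++ y :: CD.2)).
Proof.
elim: s1 F => [|a s1 IH] F /=; first by rewrite big_seq1 big_cat !big_map /= -big_split.
rewrite !big_cat !big_map /=; congr (_ + _).
  by rewrite (IH (fun A B => F (a :: A) B)).
by rewrite (IH (fun A B => F A (a :: B))).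
Qed.

Lemma smax_total_notin (x : int) (s : seq nat) : x != 0 -> path ltn 0 s ->
  `|x|%N \notin s -> smax_total x s = 0.
Proof.
move=> x0 ps xs; rewrite /smax_total big_seq big1 // => w ws.
have [pw _] := words_sound ps ws.
suff : smax w != x by move/negPf->; rewrite mul0r.
have [->|w0] := eqVneq w [::]; first by rewrite eq_sym.
apply: contraNneq xs => <-; rewrite -(perm_mem pw) map_f //.
exact: smax_mem (path_good ps pw) w0.
Qed.

Lemma smax_total_head (e : bool) (y : nat) (s : seq nat) : path ltn 0 (y :: s) ->
  smax_total (sgz_of e y) (y :: s) =
    if e then tot (size s) else (size s == 0%N)%:R * u.
Proof.
move=> ps; have /andP[y0 psy] : (0 < y)%N && path ltn y s := ps.
have xy : (sgz_of e y == y%:Z) = e.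
  by rewrite /sgz_of; case: e; rewrite ?eqxx //; case: y y0 {ps psy}.
have xNy : (sgz_of e y == - y%:Z) = ~~ e.
  by rewrite -xy /sgz_of; case: (e); rewrite ?eqxx //; case: y y0 {ps psy xy} => // y _; rewrite eqxx.
have x0 : sgz_of e y != 0 by rewrite sgz_of_eq0 -lt0n.
case: s ps psy => [|b s] ps psy.
  by rewrite smax_total1 // xy xNy; case: e {xy xNy x0} => /=; rewrite ?tot0; ring.
rewrite smax_total_cons // xy total_size ?(path_ltn_behead ps) // big_seq big1.
  by case: e {xy xNy x0} => /=; ring.
move=> [A B] /splits_subseq[sA _ _] /=; rewrite smax_total_notin ?mul0r //.
  exact: path_ltn_subseq sA (path_ltn_behead ps).
rewrite absz_sgz_of; apply: contraL psy => /(mem_subseq sA) yA.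
by apply/negP => /(order_path_min ltn_trans)/allP/(_ y yA); rewrite ltnn.
Qed.

(** The root [a] is not the signed maximum, and a splitting contributes only if [y] lies in the part
    that [smax] follows. *)
Lemma smax_total_split (e : bool) (y a : nat) (s1 s2 : seq nat) :
  path ltn 0 (a :: s1 ++ y :: s2) ->
  smax_total (sgz_of e y) (a :: s1 ++ y :: s2) =
  \sum_(AB <- splits s1) \sum_(CD <- splits s2)
    smax_total (sgz_of e y) (AB.1 ++ y :: CD.1) * total (AB.2 ++ CD.2).
Proof.
move=> ps; have ps' := path_ltn_behead ps.
have ay : (a < y)%N.
  have /andP[_ pa] : (0 < a)%N && path ltn a (s1 ++ y :: s2) := ps.
  by apply: (allP (order_path_min ltn_trans pa)); rewrite mem_cat mem_head orbT.
have x0 : sgz_of e y != 0 by rewrite sgz_of_eq0; lia.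
have xa : (sgz_of e y == a%:Z) = false by apply/eqP => /(congr1 absz); rewrite absz_sgz_of; lia.
have [b [s Es]] : exists b s, s1 ++ y :: s2 = b :: s.
  by case: s1 {ps ps'} => [|b s1]; [exists y, s2|exists b, (s1 ++ y :: s2)].
rewrite Es smax_total_cons -?Es // xa mul0r add0r.
rewrite (sum_splits_cat _ _ _ (fun A B => smax_total _ A * total B)).
apply: eq_big_seq => -[A B] /splits_subseq[sA sB _].
apply: eq_big_seq => -[C D] /splits_subseq[sC sD _] /=.
have us : uniq (s1 ++ y :: s2) := sorted_uniq ltn_trans ltnn (path_sorted ps').
rewrite [X in _ + X * _](smax_total_notin x0) ?mul0r ?addr0 //.
  by apply: path_ltn_subseq ps'; apply: cat_subseq sA _; apply: subseq_trans sC (subseq_cons _ _).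
rewrite absz_sgz_of mem_cat; move: us; rewrite cat_uniq /= negb_or.
case/and3P=> _ /andP[ys1 _] /andP[ys2 _].
by apply/norP; split; [apply: contra ys1|apply: contra ys2]; apply: mem_subseq.
Qed.

(** The first hypothesis is the induction hypothesis of [smax_total_size]. Keeping it as a premise
    lets [phi_S] reuse the computation. *)
Lemma smax_total_spl_sum (e : bool) (y a : nat) (s1 s2 : seq nat) :
  (forall A C, (size A <= size s1)%N -> path ltn 0 (A ++ y :: C) ->
     smax_total (sgz_of e y) (A ++ y :: C) = phi e (size A) (size C)) ->
  path ltn 0 (a :: s1 ++ y :: s2) ->
  smax_total (sgz_of e y) (a :: s1 ++ y :: s2) =
    spl_sum (size s1) (fun i j => spl_sum (size s2) (fun k l => phi e i k * tot (j + l)%N)).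
Proof.
move=> H pa; have pa' := path_ltn_behead pa; rewrite smax_total_split //.
pose F A B := \sum_(CD <- splits s2) smax_total (sgz_of e y) (A ++ y :: CD.1)
   * total (B ++ CD.2).
apply: (sum_splits_size (F := F)) => A B sA sB.
pose G C D := smax_total (sgz_of e y) (A ++ y :: C) * total (B ++ D).
apply: (sum_splits_size (F := G)) => C D sC sD.
rewrite /G H ?total_size ?size_cat ?size_subseq //.
- apply: path_ltn_subseq pa'; apply: cat_subseq sB _.
  exact: subseq_trans sD (subseq_cons _ _).
- by apply: path_ltn_subseq pa'; rewrite cat_subseq //= eqxx.
Qed.

Lemma iota_split (p r : nat) : iota 1 (p + r.+1) = iota 1 p ++ p.+1 :: iota p.+2 r.
Proof. by rewrite iotaD add1n. Qed.

Lemma smax_total_size (e : bool) (y : nat) (s1 s2 : seq nat) :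
  path ltn 0 (s1 ++ y :: s2) ->
  smax_total (sgz_of e y) (s1 ++ y :: s2) = phi e (size s1) (size s2).
Proof.
have [m] := ubnP (size s1); elim: m s1 y s2 => // m IH [|a s1] y s2 sm ps.
  by rewrite /phi add0n !smax_total_head ?size_iota //; apply: (path_iota (size s2).+1).
have pphi := path_iota ((size s1).+1 + (size s2).+1).
rewrite /phi; rewrite iota_split /= in pphi *.
by rewrite !smax_total_spl_sum ?size_iota // => A C sA pAC; apply: IH => //;
  apply: leq_ltn_trans sA _.
Qed.

Lemma phi_S (e : bool) (p r : nat) :
  phi e p.+1 r = spl_sum p (fun i j => spl_sum r (fun k l => phi e i k * tot (j + l)%N)).
Proof.
have := path_iota (p.+1 + r.+1); rewrite [phi e p.+1 r]/phi iota_split /= => ps.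
rewrite smax_total_spl_sum ?size_iota // => A C _; exact: smax_total_size.
Qed.

Lemma phi_0 (e : bool) (r : nat) : phi e 0 r = if e then tot r else (r == 0%N)%:R * u.
Proof. by rewrite /phi smax_total_head ?size_iota //; apply: (path_iota r.+1). Qed.

(** * Recurrences for [phi] *)

(** The letter of largest absolute value is a leaf, so making it negative only adds one peak. *)
Lemma phi_max (p : nat) : phi false p 0 = u * phi true p 0.
Proof.
have [m] := ubnP p; elim: m p => // m IH [|p] pm.
  by rewrite !phi_0 tot0 mulr1 mul1r.
rewrite !phi_S -spl_sumZ; apply: eq_spl_sum => i j ij /=.
by rewrite IH ?mulrA //; lia.
Qed.

(* The splittings separating the two adjacent letters cancel. *)
Lemma phi_exchange (e : bool) (p r : nat) :
  phi e p.+2 r - phi e p.+1 r.+1 =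
  spl_sum p (fun i j => spl_sum r (fun k l => (phi e i.+1 k - phi e i k.+1) * tot (j + l)%N)).
Proof.
apply/eqP; rewrite subr_eq !phi_S -spl_sumD /=; apply/eqP.
apply: eq_spl_sum => i j _; rewrite -!spl_sumD; apply: eq_spl_sum => k l _.
by rewrite addSn addnS; ring.
Qed.

Lemma phi_neg (p r : nat) : phi false p.+1 r - phi false p r.+1 = u * phi true p r.
Proof.
have [m] := ubnP p; elim: m p r => // m IH [|p] r pm.
  (* A negative least letter is the signed maximum only when alone, so the splitting sum reduces to
     the term k = 0, which is [u * tot r]. *)
  rewrite phi_S !phi_0 /= mul0r subr0 -(spl_sum_left0 r (fun k l => tot l)) -spl_sumZ.
  by apply: eq_spl_sum => k l _; rewrite phi_0 add0n; ring.
rewrite phi_exchange phi_S -spl_sumZ; apply: eq_spl_sum => i j ij.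
rewrite -spl_sumZ; apply: eq_spl_sum => k l _.
by rewrite IH ?mulrA //; lia.
Qed.

Lemma phi_pos (p r : nat) : phi true p r.+1 - phi true p.+1 r = phi false p r.
Proof.
have [m] := ubnP p; elim: m p r => // m IH [|p] r pm.
  (* At p = 0 the claim is [tot_S], whose correction term is [phi false 0 r]. *)
  have -> : phi true 1 r = spl_sum r (fun k l => tot k * tot l).
    by rewrite phi_S /=; apply: eq_spl_sum => k l _; rewrite phi_0 add0n.
  by rewrite !phi_0 tot_S; ring.
rewrite -opprB phi_exchange phi_S -mulN1r -spl_sumZ; apply: eq_spl_sum => i j ij.
rewrite -spl_sumZ; apply: eq_spl_sum => k l _.
by rewrite -(IH i k); [ring|lia].
Qed.

End WeightedSums.

(** * Comparison with the Arnold-Hoffman polynomials *)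

Lemma t_neq0 : t != 0.
Proof. by rewrite /t tofrac_eq0 polyX_eq0. Qed.

Definition tm2 : ratfrac := t ^- 2.

(** Induction on the row: negative indices descend from V_{n,-n} by [phi_neg]. Then [phi_max] gives
    V_{n,1}, from which positive indices ascend by [phi_pos]. *)
Lemma V_phi (p r : nat) :
  V (p + r).+1 r.+1%:Z = t ^+ (p + r).+2 * phi tm2 true p r /\
  V (p + r).+1 (- r.+1%:Z) = t ^+ (p + r).+2 * phi tm2 false p r.
Proof.
have t0 := t_neq0; have tt : t ^+ 2 * tm2 = 1 by rewrite mulfV ?expf_neq0.
have tV : t^-1 = t * tm2 by apply: (mulfI t0); rewrite mulfV // mulrA -expr2 tt.
move En: (p + r)%N => n; elim: n p r En => [|n IH] p r En.
  have [-> ->] : p = 0%N /\ r = 0%N by lia.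
  by rewrite V_one_pos V_one_neg !phi_0 tot0 mulr1 mul1r tt.
(* The induction on [q] starts at V_{n,-n} = 0, where [phi_0] vanishes because larger letters are
   present. *)
have neg q s : (q + s)%N = n.+1 ->
    V n.+2 (- s.+1%:Z) = t ^+ n.+3 * phi tm2 false q s.
  elim: q s => [|q IHq] s Es.
    rewrite phi_0 -Es add0n; case: s Es => [//|s] Es.
    by rewrite (@V_negn s.+2) // mul0r mulr0.
  rewrite V_neg; last by lia.
  have -> : - s.+1%:Z - 1 = - s.+2%:Z by lia.
  rewrite IHq; last by lia.
  rewrite [n.+2.-1]/=; have [|-> _] := IH q s; first by lia.
  rewrite tV -[phi tm2 false q.+1 s](subrK (phi tm2 false q s.+1)) phi_neg.
  by rewrite [t ^+ n.+3]exprS; ring.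
split; last exact: neg.
elim: r p En => [|r IHr] p En.
  rewrite addn0 in En; rewrite V_pos1 // (neg p 0%N) ?addn0 // phi_max; by rewrite mulrCA [t ^+ 2 * (_ * _)]mulrA tt mul1r.
rewrite V_pos; last by lia.
have -> : r.+2%:Z - 1 = r.+1%:Z by lia.
have -> : - r.+2%:Z + 1 = - r.+1%:Z by lia.
rewrite (IHr p.+1); last by lia.
rewrite [n.+2.-1]/=; have [|_ ->] := IH p r; first by lia.
rewrite -[phi tm2 true p r.+1](subrK (phi tm2 true p.+1 r)) phi_pos.
by rewrite [t ^+ n.+3]exprS; ring.
Qed.

(** * Signed permutations as words, flip classes as normal words *)

Lemma absz_window (n : nat) (s : sperm n) :
  map absz (window s) = [seq (s.1 i).+1 | i <- enum 'I_n].
Proof.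
rewrite /window -map_comp; apply: eq_map => i /=.
by case: ifP; rewrite ?abszN.
Qed.

Lemma perm_window (n : nat) (s : sperm n) : perm_eq (map absz (window s)) (iota 1 n).
Proof.
rewrite absz_window -[1%N]/(1 + 0)%N iotaDl -val_enum_ord -map_comp.
rewrite (map_comp (fun i : 'I_n => i.+1) s.1); apply: perm_map.
apply: uniq_perm; rewrite ?(map_inj_uniq (@perm_inj _ s.1)) ?enum_uniq //.
move=> i; rewrite mem_enum; apply/mapP; exists ((s.1)^-1%g i); first by rewrite mem_enum.
by rewrite permKV.
Qed.

Lemma size_window (n : nat) (s : sperm n) : size (window s) = n.
Proof. by rewrite size_map size_enum_ord. Qed.

Lemma good_window (n : nat) (s : sperm n) : good (window s).
Proof. exact: path_good (path_iota n) (perm_window s). Qed.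

Lemma window_inj (n : nat) : injective (@window n).
Proof.
move=> [s S] [s' S'] /eq_in_map /= H.
have {}H i : (if i \in S then - (s i).+1%:Z else (s i).+1%:Z) =
             (if i \in S' then - (s' i).+1%:Z else (s' i).+1%:Z).
  by apply: H; rewrite mem_enum.
congr pair.
  apply/permP => i; apply/val_inj; move: (congr1 absz (H i)).
  by case: ifP => _; case: ifP => _; rewrite ?abszN => -[].
by apply/setP => i; move: (H i); case: ifP => _; case: ifP.
Qed.

Lemma window_surj (n : nat) (w : seq int) : perm_eq (map absz w) (iota 1 n) ->
  exists s : sperm n, window s = w.
Proof.
move=> pw; have sw : size w = n by rewrite -(size_map absz) (perm_size pw) size_iota.
have bnd (i : 'I_n) : (0 < `|nth 0%R w i| <= n)%N.
  have : `|nth 0%R w i|%N \in iota 1 n by rewrite -(perm_mem pw) map_f // mem_nth ?sw.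
  by rewrite mem_iota; lia.
have bnd' (i : 'I_n) : (`|nth 0%R w i|.-1 < n)%N by have := bnd i; lia.
pose f (i : 'I_n) := Ordinal (bnd' i).
have finj : injective f.
  move=> i j /(congr1 val) /= e; apply/val_inj/eqP.
  have uw : uniq (map absz w) by rewrite (perm_uniq pw) iota_uniq.
  rewrite -(nth_uniq 0%N _ _ uw) ?size_map ?sw ?ltn_ord //.
  rewrite !(nth_map (0 : int)) ?sw ?ltn_ord //.
  by apply/eqP; rewrite -[LHS]prednK ?e ?prednK //; [case/andP: (bnd j)|case/andP: (bnd i)].
exists (perm finj, [set i : 'I_n | nth 0 w i < 0]).
apply: (@eq_from_nth _ 0); first by rewrite size_window sw.
move=> i; rewrite size_window => ilt.
rewrite (nth_map (Ordinal ilt)) ?size_enum_ord //.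
have -> : nth (Ordinal ilt) (enum 'I_n) i = Ordinal ilt.
  by apply/val_inj; rewrite /= nth_enum_ord.
rewrite permE inE /= prednK; last by case/andP: (bnd (Ordinal ilt)).
case: ifP => [/ltz0_abs->|/negbT]; first by rewrite opprK.
by rewrite -leNgt => /gez0_abs.
Qed.

Lemma nf_flip_equiv (n : nat) (s s' : sperm n) :
  flip_equiv s s' -> nf (window s) = nf (window s').
Proof.
have H (s1 s2 : sperm n) : is_flip s1 s2 -> nf (window s2) = nf (window s1).
  case/existsP=> k /and3P[k0 fk /eqP->]; apply: nf_flip fk; first exact: good_window.
  by rewrite k0 size_window -ltnS ltn_ord.
case/connectP=> p + ->; elim: p s => [//|s1 p IH] s /= /andP[/orP e /IH <-].
by case: e => /H.
Qed.

Lemma flip_equiv_sym (n : nat) : symmetric (@flip_equiv n).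
Proof. by apply: sym_connect_sym => s s'; rewrite orbC. Qed.

Lemma flip_reach_equiv (n : nat) (s : sperm n) (w : seq int) :
  flip_reach (window s) w -> exists2 s', window s' = w & flip_equiv s s'.
Proof.
elim=> [|w' k _ [s' <- ss'] /andP[k0 kn] fk]; first by exists s => //; apply: connect0.
have [s2 Es2] : exists s2 : sperm n, window s2 = flip_word k (window s').
  apply: window_surj; apply: perm_trans (perm_window s').
  by apply: perm_map; apply: perm_flip_word.
exists s2 => //; apply: connect_trans ss' (connect1 _); apply/orP; left.
apply/existsP; rewrite size_window in kn.
by exists (inord k); rewrite inordK // k0 fk Es2 eqxx.
Qed.

(** Flips preserve [nf]. Conversely, both windows reach their common normal form by flips. *)
Lemma flip_equivE (n : nat) (s s' : sperm n) :
  flip_equiv s s' = (nf (window s) == nf (window s')).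
Proof.
apply/idP/eqP => [|e]; first exact: nf_flip_equiv.
have [s1 E1 e1] := flip_reach_equiv (flip_reach_nf (good_window s)).
have [s2 E2 e2] := flip_reach_equiv (flip_reach_nf (good_window s')).
have s12 : s1 = s2 by apply: window_inj; rewrite E1 E2.
by apply: connect_trans e1 _; rewrite s12 -/(flip_equiv s2 s') flip_equiv_sym.
Qed.

Lemma perm_normal_words (n : nat) :
  perm_eq [seq window s | s <- enum [pred s : sperm n | nf (window s) == window s]]
          (words (iota 1 n)).
Proof.
apply: uniq_perm; first by rewrite map_inj_uniq ?enum_uniq //; apply: window_inj.
  exact: uniq_words (path_iota n).
move=> w; apply/mapP/idP => [[s + ->]|ww].
  rewrite mem_enum inE => /eqP <-; exact: words_complete (path_iota n) (perm_window s).
have [pw nw] := words_sound (path_iota n) ww.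
have [s Es] := window_surj pw.
by exists s => //; rewrite mem_enum inE Es nw.
Qed.

Lemma sum_flip_classes (n : nat) (x : int) (F : nat -> ratfrac) :
  \sum_(C in flip_classes n | smax_class C == x) F (spk_class C) =
  \sum_(w <- words (iota 1 n) | smax w == x) F (spk w).
Proof.
rewrite -(perm_big _ (perm_normal_words n)) big_map big_enum_cond /=.
pose cls (s : sperm n) := [set s' in [set: sperm n] | flip_equiv s s'].
pose K := [set s : sperm n | nf (window s) == window s].
(* Each class is the class of a normal window, and the injectivity of [cls] on [K] below makes that
   window unique. *)
have -> : flip_classes n = cls @: K.
  apply/setP => C; apply/imsetP/imsetP => [[s _ ->]|[s _ ->]]; last by exists s.
  have [s1 E1 e1] := flip_reach_equiv (flip_reach_nf (good_window s)).
  have E2 : nf (window s1) = window s1 by rewrite -(nf_flip_equiv e1).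
  exists s1; first by rewrite inE E2.
  by apply/setP => s'; rewrite !inE !flip_equivE E2 E1.
(* Whichever representative [pick] returns, it has the normal form of [s], which determines [smax]
   and [spk]. *)
have clsE s : {s' | [pick s' in cls s] = Some s' & nf (window s') = nf (window s)}.
  case: pickP => [s'|/(_ s)]; last by rewrite !inE flip_equivE eqxx.
  by rewrite !inE flip_equivE => /eqP e; exists s'.
have smaxE' s : smax_class (cls s) = smax (window s).
  rewrite /smax_class; have [s' -> e] := clsE s.
  by rewrite -(smax_nf (good_window s')) e smax_nf ?good_window.
have spkE' s : spk_class (cls s) = spk (window s).
  rewrite /spk_class; have [s' -> e] := clsE s.
  by rewrite -(spk_nf (good_window s')) e spk_nf ?good_window.
rewrite big_imset_cond /=; last first.
  move=> s s'; rewrite !inE => /eqP es /eqP es' /setP/(_ s').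
  by rewrite !inE !flip_equivE es es' eqxx => /eqP/window_inj.
by apply: eq_big => [s|s _]; rewrite ?inE ?smaxE' ?spkE'.
Qed.

Lemma sum_flip_classes_phi (e : bool) (p r : nat) :
  \sum_(C in flip_classes (p + r).+1 | smax_class C == sgz_of e p.+1)
    t ^ ((p + r).+1%:Z + 1 - 2 * (spk_class C)%:Z) =
  t ^+ (p + r).+2 * phi tm2 e p r.
Proof.
rewrite (sum_flip_classes _ _ (fun m => t ^ ((p + r).+1%:Z + 1 - 2 * m%:Z))).
rewrite /phi /smax_total addnS big_distrr [LHS]big_mkcond /=.
apply: eq_bigr => w _; case: ifP => _; last by rewrite mul0r mulr0.
rewrite mul1r.
have -> : (p + r).+1%:Z + 1 - 2 * (spk w)%:Z = (p + r).+2%:Z - (2 * spk w)%:Z by lia.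
by rewrite expfzDr ?t_neq0 // /tm2 -exprVn -exprM exprVn exprnN.
Qed.

Theorem theorem2p4 (n k : nat) (hk : (1 <= k <= n)%N) :
  V n k%:Z =
    \sum_(C in FLB n (n - k + 1)) t ^ (n%:Z + 1 - 2 * (spk_class C)%:Z)
  /\
  V n (- k%:Z) =
    \sum_(C in FLD n (n - k + 1)) t ^ (n%:Z + 1 - 2 * (spk_class C)%:Z).
Proof.
(* There are p = n - k letters below n - k + 1 and r = k - 1 above it. *)
have [p [r [-> ->]]] : exists p r, n = (p + r).+1 /\ k = r.+1.
  by exists (n - k)%N, k.-1; lia.
have -> : ((p + r).+1 - r.+1 + 1)%N = p.+1 by lia.
have [-> ->] := V_phi p r.
by split; rewrite -sum_flip_classes_phi; apply: eq_bigl => C; rewrite inE.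
Qed.
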